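(* Let $G$ be a finite cyclic-by-abelian group with trivial center such that $\vec \Delta_{\rm norm} (G)$ is strongly connected. Then $\mathrm{diam}(\vec \Delta_{\rm norm} (G)) \leq 4$.
   Context: A group $G$ is cyclic-by-abelian if it has a cyclic normal subgroup $N$ such that $G/N$ is abelian. For a group $G$ and $x,y\in G$, write $x\to y$ if $\langle x\rangle$ is normal in $\langle x,y\rangle$ (equivalently, $y$ normalizes $\langle x\rangle$), and $x\leftrightarrow y$ if both $x\to y$ and $y\to x$. The directed normalizing graph $\vec\Gamma_{\rm norm}(G)$ is the simple directed graph with vertex set $G$ and with an arc from $x$ to $y$ ($x\neq y$) whenever $x\to y$. $\mathrm{Univ}(G)$ is the set of those $x\in G$ with $x\leftrightarrow y$ for all $y\in G$. $\vec\Delta_{\rm norm}(G)$ is the induced subgraph of $\vec\Gamma_{\rm norm}(G)$ on $G\setminus\mathrm{Univ}(G)$. A directed graph is strongly connected if for every ordered pair of vertices $(u,v)$ there is a directed path from $u$ to $v$; its diameter $\mathrm{diam}$ is then the supremum, over ordered pairs of distinct vertices $(u,v)$, of the length of a shortest directed path from $u$ to $v$. *)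

(* Defs.v *)
From mathcomp Require Import all_boot all_fingroup all_solvable.

Set Implicit Arguments.
Unset Strict Implicit.
Unset Printing Implicit Defensive.

Local Open Scope group_scope.

Section Digraph.

Variable T : finType.
Implicit Types (V : {set T}) (e : rel T).

Definition induced_arc V e : rel T :=
  [rel x y | [&& x \in V, y \in V & e x y]].

Definition strongly_connected V e : Prop :=
  {in V &, forall u v, connect (induced_arc V e) u v}.

Definition has_path_of_length V e (u v : T) (n : nat) : bool :=
  [exists p : n.-tuple T, path (induced_arc V e) u p && (last u p == v)].

(* The least length of a directed path from u to v. A shortest path repeats no
   vertex, so searching the lengths n < #|T| is enough; the value is #|T| when
   v is not reachable from u. *)
Definition distance V e (u v : T) : nat :=
  find (has_path_of_length V e u v) (iota 0 #|T|).

(* Meaningful only when the graph is strongly connected. *)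
Definition diameter V e : nat :=
  \max_(u in V) \max_(v in V | v != u) distance V e u v.

End Digraph.

Section NormalizingGraph.

Variable gT : finGroupType.
Implicit Types (G : {group gT}) (x y : gT).

Definition cyclic_by_abelian G : Prop :=
  exists N : {group gT}, [/\ cyclic N, N <| G & abelian (G / N)].

Definition norm_to x y : bool := <[x]> <| <<[set x; y]>>.

Definition norm_arc G : rel gT :=
  [rel x y | [&& x \in G, y \in G, x != y & norm_to x y]].

Definition Univ G : {set gT} :=
  [set x in G | [forall y in G, norm_to x y && norm_to y x]].

Definition Delta_vertices G : {set gT} := G :\: Univ G.

Definition Delta_strongly_connected G : Prop :=
  strongly_connected (Delta_vertices G) (norm_arc G).

Definition Delta_diameter G : nat :=
  diameter (Delta_vertices G) (norm_arc G).

End NormalizingGraph.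

(* Main.v *)
(* An element x of prime order in Univ(G) is central, for if y does not centralize x then
   [x, y] is a generator of <x> lying in <y>; so Univ(G) = 1 when Z(G) = 1.
   Let N be cyclic and normal with G / N abelian. Every n in N dominates every vertex, so
   it suffices to find w <> 1 in H = C_G(u) centralizing some n <> 1 in N: then
   u -> w -> n -> v. If there is no such w, let y normalize <w> with w <> 1 in H. The
   commutators [w, y] and then [u, y] lie in N, the first centralizes u and the second w,
   so both are trivial and y is in H. Hence no path leaves H, whereas H meets N trivially:
   this contradicts strong connectivity. The diameter is thus in fact at most 3. *)
Require Import Defs.
From mathcomp Require Import all_boot all_fingroup all_solvable.

Set Implicit Arguments.
Unset Strict Implicit.
Unset Printing Implicit Defensive.

Local Open Scope group_scope.

Section Distance.

Variables (T : finType) (V : {set T}) (e : rel T).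

Lemma distance_le_path (u : T) (p : seq T) :
  path (induced_arc V e) u p -> distance V e u (last u p) <= size p.
Proof.
move=> up; rewrite /distance; set a := has_path_of_length V e u _.
(* A path with at least [#|T|] arcs needs no search: [find] never exceeds the length of the list. *)
case: (ltnP (size p) #|T|) => [ltp | lep]; last first.
  by apply: leq_trans (find_size _ _) _; rewrite size_iota.
rewrite leqNgt; apply/negP => /(before_find 0); rewrite nth_iota // add0n.
by move/existsP; apply; exists (in_tuple p); rewrite up eqxx.
Qed.

(** Consecutive vertices of a chain may coincide; dropping the repetitions only shortens it. This
    avoids case distinctions on equalities in the final chain. *)
Lemma distance_le_lazy_path (u : T) (p : seq T) :
  path [rel x y | (x == y) || induced_arc V e x y] u p ->
  distance V e u (last u p) <= size p.
Proof.
suff: path [rel x y | (x == y) || induced_arc V e x y] u p ->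
  exists q, [/\ path (induced_arc V e) u q, last u q = last u p & size q <= size p].
  by move=> h /h[q [uq <- le_qp]]; apply: leq_trans (distance_le_path uq) le_qp.
elim: p u => [|x p IHp] u /=; first by exists [::].
case/andP=> /orP[/eqP<- | ux] /IHp[q [uq lq le_qp]].
  by exists q; split=> //; apply: leqW.
by exists (x :: q); rewrite /= ux.
Qed.

Lemma diameter_le (d : nat) :
  {in V &, forall u v, u != v -> distance V e u v <= d} -> diameter V e <= d.
Proof.
move=> le_d; apply/bigmax_leqP => u Vu; apply/bigmax_leqP => v /andP[Vv ne_vu].
by apply: le_d; rewrite // eq_sym.
Qed.

Lemma connect_closed (r : rel T) (A : {set T}) (u v : T) :
  {in A, forall x y, r x y -> y \in A} -> u \in A -> connect r u v -> v \in A.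
Proof.
move=> clA Au /connectP[p rp ->]; elim: p u Au rp => //= x p IHp u Au /andP[rux].
by apply: IHp; apply: clA rux.
Qed.

End Distance.

Section NormalizingGraph.

Variables (gT : finGroupType) (G : {group gT}).
Implicit Types (u v w x y n : gT).

Lemma norm_toE x y : norm_to x y = (y \in 'N(<[x]>)).
Proof.
rewrite /norm_to /normal gen_subG sub1set mem_gen ?set21 //= gen_subG subUset !sub1set.
by rewrite (subsetP (normG _)) // cycle_id.
Qed.

Lemma Univ_trivial : 'Z(G) = 1 -> Univ G = 1.
Proof.
move=> Z1; apply/setP=> x; rewrite !inE; apply/andP/eqP => [[Gx Ux] | ->]; last first.
  split=> //; apply/forall_inP=> y Gy; rewrite !norm_toE group1 andbT.
  by rewrite cycle1 norm1 inE.
apply/eqP; rewrite -order_eq1; apply: contraT => ne1.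
have [p pr_p dv_p] : exists2 p, prime p & p %| #[x].
  by exists (pdiv #[x]); rewrite ?pdiv_dvd ?pdiv_prime // ltn_neqAle eq_sym ne1 order_gt0.
have [z xz oz] := Cauchy pr_p dv_p.
suff: z \in 'Z(G) by rewrite Z1 => /set1P z1; rewrite -oz z1 order1 in pr_p.
have Gz : z \in G by apply: subsetP xz; rewrite cycle_subG.
rewrite inE Gz; apply/centP => y Gy.
move/forall_inP/(_ y Gy): Ux; rewrite !norm_toE => /andP[Nxy Nyx].
have Nyz : z \in 'N(<[y]>) by apply: subsetP xz; rewrite cycle_subG.
(* Subgroups of a cyclic group are characteristic, so [y] normalizes [<[z]>] along with [<[x]>]. *)
have Nzy : y \in 'N(<[z]>).
  apply: subsetP Nxy; apply: char_norms.
  by rewrite (sub_cyclic_char _ (cycle_cyclic x)) cycle_subG.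
have Cz : [~ z, y] \in <[z]> by rewrite commgEl groupM ?groupV ?memJ_norm ?cycle_id.
have Cy : [~ z, y] \in <[y]> by rewrite commgEr groupM ?memJ_norm ?groupV ?cycle_id.
(* Since [z] has prime order, either [z] lies in the abelian group [<[y]>], or the intersection
   containing [[~ z, y]] is trivial. *)
have [zy | tiyz] : <[z]> \subset <[y]> \/ <[y]> :&: <[z]> = 1.
  by apply: prime_subgroupVti; rewrite -orderE oz.
- by apply: (centsP (cycle_abelian y)); rewrite ?cycle_id // -cycle_subG.
by apply/commgP/eqP/set1gP; rewrite -tiyz inE Cy.
Qed.

Variable N : {group gT}.
Hypotheses (nsNG : N <| G) (abGN : abelian (G / N)).

Lemma commg_in_kernel : {in G &, forall x y, [~ x, y] \in N}.
Proof.
by move=> x y Gx Gy; apply: (subsetP (der1_min (normal_norm nsNG) abGN)); apply: mem_commg.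
Qed.

(** If [N] were trivial, [G] would be abelian, hence equal to its center. *)
Lemma kernel_neq1 : 'Z(G) = 1 -> G :!=: 1 -> N :!=: 1.
Proof.
move=> Z1; apply: contraNneq => N1; rewrite -subG1 -Z1 subsetI subxx.
by apply/centsP=> x Gx y Gy; apply/commgP; rewrite -in_set1 -set1gE -N1 commg_in_kernel.
Qed.

Lemma norm_cycle_sub_cent u w :
    u \in G -> w \in 'C_G[u] -> 'C_N[u] = 1 -> 'C_N[w] = 1 ->
  {in G, forall y, y \in 'N(<[w]>) -> y \in 'C[u]}.
Proof.
move=> Gu /setIP[Gw cuw] Cu1 Cw1 y Gy nwy.
have cwy : y \in 'C[w].
  rewrite cent1C; apply/cent1P/commgP; rewrite -in_set1 -set1gE -Cu1 inE commg_in_kernel //=.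
  rewrite -cycle_subG in cuw.
  by rewrite (subsetP cuw) // commgEl groupM ?groupV ?memJ_norm ?cycle_id.
(* Now [y] and [u] both centralize [w], hence so does their commutator. *)
apply/cent1P/commgP; rewrite -in_set1 -set1gE -Cw1 inE commg_in_kernel //=.
by rewrite groupR // cent1C.
Qed.

Lemma centralizing_chain u :
    'Z(G) = 1 -> Delta_strongly_connected G -> u \in G -> u != 1 ->
  exists w n, [/\ w \in 'C_G[u], w != 1, n \in 'C_N[w] & n != 1].
Proof.
move=> Z1 connG Gu nt_u.
have VE : Delta_vertices G = G^# by rewrite /Delta_vertices Univ_trivial.
have ntG : G :!=: 1 by apply/trivgPn; exists u.
have [n Nn nt_n] := trivgPn _ (kernel_neq1 Z1 ntG).
case: (boolP [exists w in 'C_G[u]^#, 'C_N[w] != 1]) => [/exists_inP[w] | ].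
  case/setD1P=> nt_w Cw /trivgPn[m Cm nt_m].
  by exists w, m.
move/exists_inPn => C1; have {}C1 w : w \in 'C_G[u]^# -> 'C_N[w] = 1.
  by move/C1; rewrite negbK => /eqP.
have Cu : u \in 'C_G[u]^# by rewrite in_setD1 in_setI nt_u Gu cent1id.
have := connG u n; rewrite VE !inE nt_u nt_n Gu (subsetP (normal_sub nsNG)) //.
move=> /(_ isT isT) /(connect_closed (A := 'C_G[u]^#)) Cn.
(* Arcs do not leave ['C_G[u]^#], so a path from [u] to [n] stays inside it. *)
have {Cn} : n \in 'C_G[u]^#.
  apply: Cn => // x Cx y /and3P[_ /setD1P[nt_y Gy] /and4P[_ _ _ nxy]].
  rewrite norm_toE in nxy; rewrite in_setD1 in_setI nt_y Gy /=.
  apply: norm_cycle_sub_cent nxy; rewrite ?C1 //.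
  by case/setD1P: Cx.
case/setD1P=> _ /setIP[_ cun]; case/eqP: nt_n.
(* The choice [w = u] in [C1] gives ['C_N[u] = 1], which contains [n]. *)
by apply/set1gP; rewrite -(C1 u Cu) inE Nn.
Qed.

End NormalizingGraph.

Theorem proposition5p19 (gT : finGroupType) (G : {group gT})
    (cbaG : cyclic_by_abelian G) (centerG : ('Z(G) = 1)%g)
    (connG : Delta_strongly_connected G) :
  Delta_diameter G <= 4.
Proof.
have [N [cycN nsNG abGN]] := cbaG.
have VE : Delta_vertices G = G^# by rewrite /Delta_vertices Univ_trivial.
apply: (@leq_trans 3) => //; apply: diameter_le => u v.
rewrite VE => /setD1P[nt_u Gu] /setD1P[nt_v Gv] _.
have [w [n []]] := centralizing_chain nsNG abGN centerG connG Gu nt_u.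
case/setIP=> Gw cuw nt_w /setIP[Nn cwn] nt_n.
have Gn := subsetP (normal_sub nsNG) n Nn.
(* [<[n]>] is characteristic in the cyclic group [N], hence normal in [G]. *)
have nnG : G \subset 'N(<[n]>).
  apply/normal_norm/(char_normal_trans _ nsNG).
  by rewrite (sub_cyclic_char _ cycN) cycle_subG.
have cent_norm (x y : gT) : y \in 'C[x] -> y \in 'N(<[x]>).
  by rewrite -cent_cycle; apply/subsetP/cent_sub.
(* The chain is lazy because [w = u], [n = w] or [n = v] may occur. *)
apply: (@distance_le_lazy_path _ _ _ u [:: w; n; v]).
rewrite /= /induced_arc /norm_arc /= !norm_toE !in_setD1 nt_u nt_w nt_n nt_v Gu Gw Gn Gv /=.
by rewrite (cent_norm _ _ cuw) (cent_norm _ _ cwn) (subsetP nnG) //= !andbT !orbN.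
Qed.
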